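(* Let $H=(V,E)$ be a finite hypergraph that has at least one bad partition, and let $\mathcal P=\{V_1,\dots,V_k\}$ be a bad partition of $V$ maximizing $$f(\mathcal P)=|\mathcal P|\frac{|V|-1}{|V|}-N(\mathcal P)$$ among all bad partitions. Then: (1) If $H'$ is a maximal (with respect to inclusion) partition-connected subhypergraph of $H$, then $V(H')\subseteq V_i$ for some $i$. (2) If $H'$ is a maximal partition-connected subhypergraph of $H$ with $V(H')\subseteq V_i$, then $V(H')=V_i$. (3) In particular, if $H_1,\dots,H_k$ are the maximal partition-connected subhypergraphs of $H$, then their vertex sets form a partition of $V$, and this partition is a bad partition. Hence such a maximizing bad partition is unique, and it consists of the vertex sets of all the maximal partition-connected subhypergraphs of $H$.
   Context: A hypergraph has a finite vertex set and a set of nonempty vertex subsets as edges; a subhypergraph $(V',E')$ of $H$ has $V'\subseteq V$, $E'\subseteq E$ with every edge of $E'$ contained in $V'$. For a partition $\mathcal P$ of $V$ into nonempty parts, $N(\mathcal P)$ is the number of edges of $E$ having vertices in at least two parts of $\mathcal P$. A partition $\mathcal P$ is good if $N(\mathcal P)\ge|\mathcal P|-1$ and bad otherwise. A hypergraph is partition-connected if every partition of its vertex set (with $N$ computed using its own edges) is good. *)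

(* Defs.v *)
From HB Require Import structures.
From mathcomp Require Import all_boot all_order all_algebra.

Set Implicit Arguments.
Unset Strict Implicit.
Unset Printing Implicit Defensive.

Import Order.TTheory GRing.Theory Num.Theory.

Section Hypergraphs.
Variable T : finType.

(* The vertex set is a subset of an ambient finite type T, so that a hypergraph
   and its subhypergraphs all live in the same (finite) type. *)
Definition is_hypergraph (VE : {set T} * {set {set T}}) : bool :=
  [forall e in VE.2, (e != set0) && (e \subset VE.1)].

Record hypergraph := Hypergraph {
  hypergraph_val : {set T} * {set {set T}};
  hypergraphP : is_hypergraph hypergraph_val
}.

HB.instance Definition _ := [isSub for hypergraph_val].
HB.instance Definition _ := [Finite of hypergraph by <:].

Definition verts (H : hypergraph) : {set T} := (hypergraph_val H).1.
Definition edges (H : hypergraph) : {set {set T}} := (hypergraph_val H).2.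

(* That the edges of H' lie inside its vertex set is part of hypergraphP. *)
Definition subhypergraph (H' H : hypergraph) : bool :=
  (verts H' \subset verts H) && (edges H' \subset edges H).

(* N(P): the number of edges with vertices in at least two parts of P. *)
Definition ncross (H : hypergraph) (P : {set {set T}}) : nat :=
  #|[set e in edges H | 2 <= #|[set A in P | e :&: A != set0]| ]|.

(* Truncated subtraction is harmless: it only matters when P is empty, and then
   N(P) >= 0 > -1 holds anyway. *)
Definition good (H : hypergraph) (P : {set {set T}}) : bool :=
  #|P| - 1 <= ncross H P.

Definition bad_partition (H : hypergraph) (P : {set {set T}}) : bool :=
  partition P (verts H) && ~~ good H P.

Definition partition_connected (H : hypergraph) : bool :=
  [forall P : {set {set T}}, partition P (verts H) ==> good H P].

Definition is_pc_sub (H H' : hypergraph) : bool :=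
  subhypergraph H' H && partition_connected H'.

Definition max_pc_subs (H : hypergraph) : {set hypergraph} :=
  [set H' | is_pc_sub H H' &
    [forall K, is_pc_sub H K ==> subhypergraph H' K ==> (K == H')]].

Definition weight (H : hypergraph) (P : {set {set T}}) : rat :=
  (#|P|%:R * ((#|verts H|%:R - 1) / #|verts H|%:R) - (ncross H P)%:R)%R.

Definition maximizing_bad_partition (H : hypergraph) (P : {set {set T}}) : bool :=
  bad_partition H P &&
  [forall Q, bad_partition H Q ==> (weight H Q <= weight H P)%R].

End Hypergraphs.

(* Main.v *)
(** For nonempty [P] one has [f(P) = (|P| - N(P)) - |P| / |V|] with
    [0 < |P| / |V| <= 1], so maximizing [f] means first maximizing [|P| - N(P)]
    and then minimizing [|P|].  If the subhypergraph induced on a part [A] of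
    a maximizing [P] had a bad partition, refining [A] by it would increase
    [|P| - N(P)]; hence the parts induce partition-connected subhypergraphs.
    If a partition-connected subhypergraph met [s >= 2] parts, merging them
    would lose [s - 1] parts and at least [s - 1] crossing edges, so
    [|P| - N(P)] would not decrease while [|P|] would.  Hence the maximal
    partition-connected subhypergraphs are exactly those induced on the parts
    of [P]. *)

Require Import Defs.
From mathcomp Require Import all_boot all_order all_algebra.
From mathcomp Require Import zify lra.

Set Implicit Arguments.
Unset Strict Implicit.
Unset Printing Implicit Defensive.

Import Order.TTheory GRing.Theory Num.Theory.

(** * Replacing parts of a partition, and traces of a partition on a subset *)

Section Partitions.
Variable T : finType.
Implicit Types (D W A : {set T}) (P Q S : {set {set T}}).

Lemma card_partition_leq P D : partition P D -> #|P| <= #|D|.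
Proof.
move=> partP; rewrite (card_partition partP) -sum1_card; apply: leq_sum => A PA.
by rewrite card_gt0 (partition_neq0 partP).
Qed.

Lemma partition_part_eq P D A B :
  partition P D -> A \in P -> B \in P -> ~~ [disjoint A & B] -> A = B.
Proof.
move=> /partition_trivIset/trivIsetP tiP PA PB; apply: contraNeq; exact: tiP.
Qed.

(** Serves two opposite operations: refining one part ([S] a singleton) and merging several parts
    ([Q] a singleton). *)
Lemma partition_replace P D S Q :
    partition P D -> S \subset P -> partition Q (cover S) ->
  partition ((P :\: S) :|: Q) D /\
    (#|(P :\: S) :|: Q| + #|S| = #|P| + #|Q|)%N.
Proof.
move=> partP sSP partQ.
have dPS : [disjoint cover (P :\: S) & cover S].
  rewrite -setI_eq0; apply/eqP/setP => x; rewrite !inE; apply/negP.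
  case/andP=> /bigcupP[A /setDP[PA nSA] Ax] /bigcupP[B SB Bx].
  case/negP: nSA; rewrite (partition_part_eq partP PA (subsetP sSP _ SB)) //.
  by apply/pred0Pn; exists x; rewrite /= Ax.
have [/eqP covQ tiQ Q0] := and3P partQ; have [/eqP covP tiP P0] := and3P partP.
split.
  apply/and3P; split.
  - rewrite /cover bigcup_setU -/(cover _) -/(cover Q) covQ -covP -bigcup_setU.
    by rewrite setDE setUIl [~: S :|: S]setUC setUCr setIT (setUidPl sSP).
  - by apply: trivIsetU => //; [apply: trivIsetD | rewrite covQ].
  - by rewrite !inE (negPf P0) (negPf Q0) andbF.
have dPQ : [disjoint P :\: S & Q].
  rewrite -setI_eq0; apply/eqP/setP => A; rewrite inE [RHS]inE; apply/negP.
  case/andP=> PSA QA; have /set0Pn[x Ax] := partition_neq0 partQ QA.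
  move: dPS; rewrite -covQ => /pred0Pn; case; exists x => /=.
  by apply/andP; split; apply/bigcupP; exists A.
rewrite cardsU (disjoint_setI0 dPQ) cards0 subn0 -(cardsID S P) (setIidPr sSP).
by lia.
Qed.

(** Distinct parts have disjoint traces, and the traces kept are nonempty, hence pairwise distinct;
    so no part is lost in counting. *)
Lemma trace_partition P D W (S := [set A in P | A :&: W != set0]) :
    partition P D -> W \subset D ->
  partition [set A :&: W | A in S] W /\ #|[set A :&: W | A in S]| = #|S|.
Proof.
move=> partP sWD; have [/eqP covP tiP P0] := and3P partP.
have R0 : set0 \notin [set A :&: W | A in S].
  by apply/imsetP => -[A]; rewrite inE => /andP[_ /[swap] <-]; rewrite eqxx.
have [|tiR inj] := trivIimset (F := fun A => A :&: W) _ R0; last first.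
  split; last exact: card_in_imset.
  rewrite /partition tiR R0 !andbT cover_imset; apply/eqP/setP => x.
  apply/bigcupP/idP => [[A _ /setIP[]//]|Wx].
  have := subsetP sWD x Wx; rewrite -covP => /bigcupP[A PA Ax].
  by exists A; rewrite !inE ?PA ?Ax //; apply/set0Pn; exists x; rewrite inE Ax.
move=> A B; rewrite !inE => /andP[PA _] /andP[PB _] neBA.
have /trivIsetP/(_ _ _ PA PB) := tiP; rewrite eq_sym => /(_ neBA).
by apply: disjointW; rewrite subsetIl.
Qed.

End Partitions.

(** * Crossing edges, the weight, and induced subhypergraphs *)

Section Hypergraphs.
Variable T : finType.
Implicit Types (H K : hypergraph T) (A : {set T}) (P Q : {set {set T}}).

Lemma edges_sub H e : e \in edges H -> e \subset verts H.
Proof. by move=> He; have /forall_inP/(_ e He)/andP[] := hypergraphP H. Qed.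

Lemma edges_neq0 H e : e \in edges H -> e != set0.
Proof. by move=> He; have /forall_inP/(_ e He)/andP[] := hypergraphP H. Qed.

Definition cut_edges H P := [set e in edges H | ~~ [exists A in P, e \subset A]].

(** A nonempty edge inside [verts H] meets some part, so it meets only one exactly when that part
    contains it. Containment is easier to follow than counting when parts are refined or merged. *)
Lemma ncrossE H P : partition P (verts H) -> ncross H P = #|cut_edges H P|.
Proof.
move=> partP; congr #|pred_of_set _|; apply/setP => e; rewrite !inE.
have [He/=|//] := boolP (e \in edges H); have sVe := edges_sub He.
have /set0Pn[x ex] := edges_neq0 He.
have covP := cover_partition partP.
have /bigcupP[A PA Ax] : x \in cover P by rewrite covP (subsetP sVe).
have meetA : A \in [set A in P | e :&: A != set0].
  by rewrite inE PA; apply/set0Pn; exists x; rewrite inE ex.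
apply/idP/idP => [|ncut].
  apply: contraL => /exists_inP[B PB seB]; rewrite -leqNgt.
  rewrite -(cards1 B) subset_leq_card //; apply/subsetP => C.
  rewrite !inE => /andP[PC /set0Pn[y /setIP[ey Cy]]]; apply/eqP.
  apply: (partition_part_eq partP PC PB); apply/pred0Pn; exists y.
  by rewrite /= Cy (subsetP seB).
have /subsetPn[y ey nAy] : ~~ (e \subset A).
  by apply: contraNN ncut => seA; apply/exists_inP; exists A.
have /bigcupP[B PB By] : y \in cover P by rewrite covP (subsetP sVe).
rewrite (cardsD1 A) meetA (cardsD1 B) !inE PB.
have -> : B != A by apply: contraNneq nAy => <-.
by have -> : e :&: B != set0 by apply/set0Pn; exists y; rewrite inE ey.
Qed.

(** With [n], [p], [q], [a], [b] as in the proof, clearing the denominator [n] gives ((q - b) - (p -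
    a)) n <= q - p. Since q - p < n, the left factor is at most 0, and if it is 0 then p <= q. *)
Lemma weight_le H P Q :
    partition P (verts H) -> partition Q (verts H) -> P != set0 ->
    (weight H Q <= weight H P)%R ->
  (#|Q| + ncross H P <= #|P| + ncross H Q)%N /\
  ((#|Q| + ncross H P)%N = (#|P| + ncross H Q)%N -> (#|P| <= #|Q|)%N).
Proof.
move=> partP partQ P0.
have := card_partition_leq partP; have := card_partition_leq partQ.
have : (0 < #|P|)%N by rewrite card_gt0.
rewrite /weight; set n := #|verts H|; set p := #|P|; set q := #|Q|.
set a := ncross H P; set b := ncross H Q => p_gt0 qn pn.
have n_gt0 : (0 < (n%:R : rat))%R by rewrite ltr0n (leq_trans p_gt0).
have scaleE r : (r%:R * ((n%:R - 1) / n%:R) * n%:R = r%:R * n%:R - r%:R :> rat)%R.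
  by rewrite -mulrA divfK ?gt_eqF // mulrBr mulr1.
rewrite -(ler_pM2r n_gt0) mulrBl [leRHS]mulrBl !scaleE => le_w.
have {}le_w : (q * n + p + a * n <= p * n + q + b * n)%N.
  by rewrite -(ler_nat rat) !natrD !natrM; move: le_w; lra.
by split => [|eq_pq]; nia.
Qed.

Fact induced_subproof H A :
  is_hypergraph (A, [set e in edges H | e \subset A]).
Proof.
apply/forall_inP => e; rewrite inE /= => /andP[He ->].
by rewrite (edges_neq0 He).
Qed.

Definition induced H A := Hypergraph (induced_subproof H A).

Lemma subhypergraph_induced H K A :
  subhypergraph K H -> verts K \subset A -> subhypergraph K (induced H A).
Proof.
case/andP=> _ sKH sKA; apply/andP; split=> //; apply/subsetP => e Ke.
by rewrite inE (subsetP sKH) // (subset_trans (edges_sub Ke)).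
Qed.

Lemma subhypergraph_anti H K :
  subhypergraph H K -> subhypergraph K H -> H = K.
Proof.
move=> /andP[sV sE] /andP[sV' sE']; apply: val_inj.
rewrite [LHS]surjective_pairing [RHS]surjective_pairing.
by congr pair; apply/eqP; rewrite eqEsubset; apply/andP.
Qed.

(** * Structure of a maximizing bad partition *)

Section Maximizing.
Variables (H : hypergraph T) (P : {set {set T}}).
Hypothesis maxP : maximizing_bad_partition H P.

Let badP : bad_partition H P. Proof. by case/andP: maxP. Qed.
Let partP : partition P (verts H). Proof. by case/andP: badP. Qed.
Let ltP : (ncross H P < #|P| - 1)%N.
Proof. by case/andP: badP => _; rewrite -ltnNge. Qed.

(** Covers good partitions as well, so refined or merged partitions can be compared with [P] without
    first being shown bad. *)
Lemma maximizing_lexicographic Q : partition Q (verts H) ->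
  (#|Q| + ncross H P <= #|P| + ncross H Q)%N /\
  ((#|Q| + ncross H P)%N = (#|P| + ncross H Q)%N -> (#|P| <= #|Q|)%N).
Proof.
move=> partQ; have [badQ|] := boolP (bad_partition H Q).
  apply: weight_le => //; first by rewrite -card_gt0; lia.
  by have /andP[_ /forall_inP] := maxP; apply.
(* A good [Q] has |Q| - N(Q) <= 1, while badness of [P] gives |P| - N(P) >= 2: the inequality is
   strict and the tie case vacuous. *)
rewrite /bad_partition partQ negbK /good; lia.
Qed.

Lemma induced_part_pc A : A \in P -> partition_connected (induced H A).
Proof.
move=> PA; apply/forall_inP => Q partQ; rewrite /good leqNgt; apply/negP => badQ.
have sAP : [set A] \subset P by rewrite sub1set.
have partQ' : partition Q (cover [set A]) by rewrite cover1.
have [partR cardR] := partition_replace partP sAP partQ'.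
have [le_R _] := maximizing_lexicographic partR.
(* An edge cut by the refinement is either cut by [P] or contained in [A] and cut by [Q]. *)
suff : (ncross H ((P :\: [set A]) :|: Q) <= ncross H P + ncross (induced H A) Q)%N.
  by move: le_R badQ cardR; rewrite cards1; lia.
rewrite !ncrossE //; apply: leq_trans (leq_card_setU _ _).1.
apply/subset_leq_card/subsetP => e; rewrite !inE => /andP[He /exists_inPn ncut].
rewrite He /=; have [/exists_inP[B PB seB]/=|//] := boolP [exists B in P, e \subset B].
have [eqBA|neBA] := eqVneq B A.
  rewrite -eqBA seB; apply/exists_inPn => C QC.
  by apply: ncut; rewrite inE QC orbT.
by have := ncut B; rewrite !inE PB neBA seB => /(_ isT).
Qed.

Lemma pc_sub_meets_one_part K : is_pc_sub H K ->
  (#|[set A in P | A :&: verts K != set0]| <= 1)%N.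
Proof.
case/andP=> /andP[sVK sEK] /forall_inP pcK.
set S := [set A in P | _]; rewrite leqNgt; apply/negP => gtS.
have [partR cardR] := trace_partition partP sVK; rewrite -/S in partR cardR.
have sSP : S \subset P by apply/subsetP => A /setIdP[].
have part1 : partition [set cover S] (cover S).
  rewrite /partition cover1 eqxx trivIset1 inE eq_sym.
  have /card_gt0P[A SA] : (0 < #|S|)%N by lia.
  have /setIdP[PA _] := SA; have /set0Pn[x Ax] := partition_neq0 partP PA.
  by apply/set0Pn; exists x; apply/bigcupP; exists A.
have [partM cardM] := partition_replace partP sSP part1.
have [le_diff min_card] := maximizing_lexicographic partM.
have := pcK _ partR; rewrite /good cardR.
(* Partition-connectedness of [K], applied to the traces, supplies |S| - 1 crossing edges. If
   merging loses them all, it at least ties with [P] while having fewer parts. *)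
suff : (ncross H ((P :\: S) :|: [set cover S]) +
        ncross K [set A :&: verts K | A in S] <= ncross H P)%N.
  by move: cardM; rewrite cards1; lia.
rewrite !ncrossE //; set X := cut_edges H _; set Y := cut_edges K _.
have sYS e : e \in Y -> e \subset cover S.
  rewrite inE => /andP[Ke _]; apply: subset_trans (edges_sub Ke) _.
  rewrite -(cover_partition partR) cover_imset.
  by apply/bigcupsP => A SA; rewrite /cover (bigcup_max A) // subsetIl.
(* Edges of [K] cut by the traces lie inside the merged part, so the merged partition does not cut
   them. *)
have dXY : X :&: Y = set0.
  apply/setP => e; rewrite inE [RHS]inE; apply/negP => /andP[Xe /sYS seS].
  move: Xe; rewrite inE => /andP[_ /exists_inPn/(_ (cover S))].
  by rewrite !inE eqxx orbT seS => /(_ isT).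
rewrite -[X in (X <= _)%N]subn0 -(cards0 {set T}) -dXY -cardsU.
apply/subset_leq_card/subsetP => e /setUP[].
  rewrite !inE => /andP[-> /exists_inPn ncut]; apply/exists_inPn => A PA.
  have [SA|nSA] := boolP (A \in S); last by apply: ncut; rewrite inE inE nSA PA.
  apply/negP => seA.
  have /negP[] : ~~ (e \subset cover S) by apply: ncut; rewrite !inE eqxx orbT.
  by rewrite /cover (bigcup_max A).
(* If a part [A] of [P] contained such an edge, the trace of [A] would contain it too and be
   nonempty, contradicting that the traces cut it. *)
rewrite !inE => /andP[Ke /exists_inPn ncut]; rewrite (subsetP sEK) //=.
apply/exists_inPn => A PA; apply/negP => seA.
have seAK : e \subset A :&: verts K by rewrite subsetI seA edges_sub.
have /negP[] : ~~ (e \subset A :&: verts K); last by [].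
apply: ncut; apply: imset_f; rewrite inE PA; have /set0Pn[x ex] := edges_neq0 Ke.
by apply/set0Pn; exists x; apply: (subsetP seAK).
Qed.

Lemma pc_sub_in_part K : is_pc_sub H K -> exists2 A, A \in P & verts K \subset A.
Proof.
move=> pcK; have /andP[/andP[sVK _] _] := pcK.
(* An empty vertex set meets no part, but any part contains it; [P] has one because it is bad. *)
have [->|/set0Pn[x Kx]] := eqVneq (verts K) set0.
  have /card_gt0P[A PA] : (0 < #|P|)%N by lia.
  by exists A; rewrite ?sub0set.
have covP := cover_partition partP.
have memS y : y \in verts K ->
    exists2 B, B \in [set A in P | A :&: verts K != set0] & y \in B.
  move=> Ky; have := subsetP sVK y Ky; rewrite -covP => /bigcupP[B PB By].
  by exists B; rewrite // inE PB; apply/set0Pn; exists y; rewrite inE By.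
have [A SA Ax] := memS x Kx; exists A; first by case/setIdP: SA.
apply/subsetP => y /memS[B SB By].
by rewrite (card_le1_eqP (pc_sub_meets_one_part pcK) B A SB SA).
Qed.

Lemma induced_part_is_pc_sub A : A \in P -> is_pc_sub H (induced H A).
Proof.
move=> PA; rewrite /is_pc_sub induced_part_pc // andbT; apply/andP; split.
  exact: partitionS partP PA.
by apply/subsetP => e; rewrite inE => /andP[].
Qed.

Lemma max_pc_subs_induced : max_pc_subs H = [set induced H A | A in P].
Proof.
apply/setP => K; rewrite inE; apply/andP/imsetP => [[pcK maxK]|[A PA ->]].
  have [A PA sKA] := pc_sub_in_part pcK; exists A => //.
  have /andP[sKH _] := pcK; apply/esym/eqP.
  have /implyP := forall_inP maxK _ (induced_part_is_pc_sub PA).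
  by apply; apply: subhypergraph_induced.
split; first exact: induced_part_is_pc_sub.
apply/forall_inP => L pcL; apply/implyP => sAL; apply/eqP.
have [B PB sLB] := pc_sub_in_part pcL.
have sAB : A \subset B by apply: subset_trans sLB; case/andP: sAL.
have eqAB : A = B.
  have /set0Pn[x Ax] := partition_neq0 partP PA.
  apply: (partition_part_eq partP) => //; apply/pred0Pn; exists x.
  by rewrite /= Ax (subsetP sAB).
apply: subhypergraph_anti sAL; rewrite eqAB.
by apply: subhypergraph_induced => //; case/andP: pcL.
Qed.

(** The left side depends on [H] alone, which yields uniqueness of [P]. *)
Lemma verts_max_pc_subs : [set verts K | K in max_pc_subs H] = P.
Proof. by rewrite max_pc_subs_induced -imset_comp imset_id. Qed.

End Maximizing.
End Hypergraphs.

Theorem theorem15 (T : finType) (H : hypergraph T)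
    (has_bad : exists Q : {set {set T}}, bad_partition H Q) :
  (forall P : {set {set T}}, maximizing_bad_partition H P ->
    (* (1) *)
    (forall H' : hypergraph T, H' \in max_pc_subs H ->
       exists2 A : {set T}, A \in P & verts H' \subset A) /\
    (* (2) *)
    (forall (H' : hypergraph T) (A : {set T}),
       H' \in max_pc_subs H -> A \in P -> verts H' \subset A ->
       verts H' = A) /\
    (* (3) *)
    [/\ #|max_pc_subs H| = #|P|,
        {in max_pc_subs H &, injective (@verts T)},
        partition [set verts H' | H' in max_pc_subs H] (verts H) &
        bad_partition H [set verts H' | H' in max_pc_subs H]] /\
    P = [set verts H' | H' in max_pc_subs H]) /\
  (exists! P : {set {set T}}, maximizing_bad_partition H P).
Proof.
split => [P maxP|].
  have /andP[badP _] := maxP; have /andP[partP _] := badP.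
  rewrite (verts_max_pc_subs maxP) (max_pc_subs_induced maxP).
  split; [|split; [|split=> //]].
  - by move=> _ /imsetP[A PA ->]; exists A.
  - move=> _ A /imsetP[B PB ->] PA sBA; apply: (partition_part_eq partP) => //.
    have /set0Pn[x Bx] := partition_neq0 partP PB.
    by apply/pred0Pn; exists x; rewrite /= Bx (subsetP sBA).
  - split=> //; last by move=> _ _ /imsetP[A _ ->] /imsetP[B _ ->] /(congr1 (induced H)).
    by apply: card_in_imset => A B _ _ /(congr1 (@verts T)).
have [Q badQ] := has_bad.
(* Existence: there are finitely many sets of subsets of [T], so the weight attains a maximum on the
   bad partitions. *)
case: (@arg_maxP _ _ _ Q (bad_partition H) (weight H) badQ) => P badP maxP.
have maxbP : maximizing_bad_partition H P.
  by rewrite /maximizing_bad_partition badP; apply/forall_inP.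
exists P; split=> // P' maxP'.
by rewrite -(verts_max_pc_subs maxbP) (verts_max_pc_subs maxP').
Qed.
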